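(* For every integer $q>1$, \[ (1+(-1)^q)T_{1,q}=(-1)^{q+1}\widetilde{t}(q+1)+(1+(-1)^q)\,2\log(2)\,\widetilde{t}(q)-2\sum_{\substack{2k_1+k_2=q\\ k_1,k_2\geq 1}} \widetilde{t}(2k_1)\zeta(k_2+1). \]
   Context: For $n\in\mathbb{N}_0$ and $p\in\mathbb{N}$ let $h_n^{(p)}=\sum_{k=1}^n (k-1/2)^{-p}$ (so $h_0^{(p)}=0$) and $h_n=h_n^{(1)}$. For positive integers $p_1,\dots,p_k$ and $q\ge 2$, the Euler $T$-sum is $T_{p_1p_2\cdots p_k,q}=\sum_{n=1}^\infty \frac{h_{n-1}^{(p_1)}\cdots h_{n-1}^{(p_k)}}{(n-1/2)^q}$. For integers $s>1$, $\widetilde{t}(s)=\sum_{n=1}^\infty (n-1/2)^{-s}=(2^s-1)\zeta(s)$, and $\zeta$ is the Riemann zeta function. *)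

(* Defs.v *)
From Stdlib Require Export Reals List.
From Coquelicot Require Export Coquelicot.
Export ListNotations.
Open Scope R_scope.

Definition Series1 (f : nat -> R) : R := Series (fun m => f (S m)).

(* h_n^(p); sum_n_m _ 1 0 is the empty sum, so h_0^(p) = 0. *)
Definition h (p n : nat) : R :=
  sum_n_m (fun k => / (INR k - 1 / 2) ^ p) 1 n.

(* T_{p_1...p_k,q}, with ps = [p_1; ...; p_k]; meaningful for q >= 2. *)
Definition T (ps : list nat) (q : nat) : R :=
  Series1 (fun n =>
    fold_right Rmult 1 (map (fun p => h p (n - 1)) ps) / (INR n - 1 / 2) ^ q).

(* Both are used only at integers s > 1, where the series converge. *)
Definition ttilde (s : nat) : R := Series1 (fun n => / (INR n - 1 / 2) ^ s).

Definition zeta (s : nat) : R := Series1 (fun n => / INR n ^ s).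

(* Main.v *)
Require Import Defs.
From Stdlib Require Import Reals List.
From Coquelicot Require Import Coquelicot.
From Stdlib Require Import Lra Lia.
Import ListNotations.
Open Scope R_scope.

(** Write [a = n - 1/2]. Truncating all series at [N], the sum over [k1] of
    [a^(-2 k1) m^(-(q + 1 - 2 k1))] is geometric with ratio [m^2 / a^2 <> 1], so the
    convolution becomes a difference of two double sums, of powers of [1/a] and of [1/m]
    against the kernel [1 / (m^2 - a^2)].  By partial fractions the inner sums of the
    kernel telescope to values of [h]:  over all [n] the kernel sums to [0], over all [m]
    it sums to [1 / (2 a^2)], and [1 / (m (m^2 - a^2))] summed over [m] gives
    [(2 ln 2 - h_(n-1) - 1 / (2 a)) / a^2], where [2 ln 2] is the limit of [h_N - H_N].
    Cutting both indices at the same [N] leaves errors of size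
    [sum_(n <= N) 1 / (n (N - n + 1/2)) = O(h_N / N)], so no interchange of infinite sums
    is needed. *)

(** * Finite sums over 1..N and their passage to series *)

Definition psum (f : nat -> R) (N : nat) : R := sum_n_m f 1 N.
Local Notation half n := (INR n - 1 / 2).

Lemma psum_O (f : nat -> R) : psum f 0 = 0.
Proof. unfold psum; now rewrite sum_n_m_zero by lia. Qed.

Lemma psum_S (f : nat -> R) N : psum f (S N) = psum f N + f (S N).
Proof. unfold psum; now rewrite sum_n_Sm by lia. Qed.

Lemma psum_ext (f g : nat -> R) N :
  (forall n, (1 <= n <= N)%nat -> f n = g n) -> psum f N = psum g N.
Proof. intros H; apply sum_n_m_ext_loc; intros; apply H; lia. Qed.

Lemma psum_plus (f g : nat -> R) N :
  psum (fun n => f n + g n) N = psum f N + psum g N.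
Proof. exact (sum_n_m_plus f g 1 N). Qed.

Lemma psum_scal (c : R) (f : nat -> R) N :
  psum (fun n => c * f n) N = c * psum f N.
Proof. exact (sum_n_m_mult_l c f 1 N). Qed.

Lemma psum_minus (f g : nat -> R) N :
  psum (fun n => f n - g n) N = psum f N - psum g N.
Proof.
  induction N as [|N IH]; [rewrite !psum_O; ring|].
  rewrite !psum_S, IH; ring.
Qed.

Lemma psum_le (f g : nat -> R) N :
  (forall n, (1 <= n <= N)%nat -> f n <= g n) -> psum f N <= psum g N.
Proof.
  intros H; induction N as [|N IH]; [rewrite !psum_O; lra|].
  rewrite !psum_S; apply Rplus_le_compat; [apply IH; intros|]; apply H; lia.
Qed.

Lemma psum_abs_le (f g : nat -> R) N :
  (forall n, (1 <= n <= N)%nat -> Rabs (f n) <= g n) ->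
  Rabs (psum f N) <= psum g N.
Proof.
  intros H; apply Rabs_le; split.
  - replace (- psum g N) with (psum (fun n => (-1) * g n) N)
      by (rewrite psum_scal; ring).
    apply psum_le; intros n Hn; specialize (H n Hn).
    apply Rabs_le_between in H; lra.
  - apply psum_le; intros n Hn; specialize (H n Hn).
    apply Rabs_le_between in H; lra.
Qed.

Lemma psum_shift (f : nat -> R) N :
  psum f (S N) = f 1%nat + psum (fun n => f (S n)) N.
Proof.
  induction N as [|N IH]; [rewrite psum_S, !psum_O; ring|].
  rewrite psum_S, IH, psum_S; ring.
Qed.

Lemma psum_rev (f : nat -> R) N :
  psum (fun n => f (S N - n)%nat) N = psum f N.
Proof.
  induction N as [|N IH]; [now rewrite !psum_O|].
  rewrite psum_shift, psum_S, Rplus_comm; f_equal.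
  rewrite <- IH; apply psum_ext; intros; f_equal; lia.
Qed.

Lemma psum_swap (f : nat -> nat -> R) N M :
  psum (fun n => psum (fun m => f n m) M) N =
  psum (fun m => psum (fun n => f n m) N) M.
Proof.
  induction N as [|N IH].
  - rewrite psum_O; symmetry.
    (* The zero summand is written [0 * 0] so that [psum_scal] evaluates its sum. *)
    transitivity (psum (fun _ => 0 * 0) M); [|rewrite psum_scal; ring].
    apply psum_ext; intros; rewrite psum_O; ring.
  - rewrite psum_S, IH, <- psum_plus; apply psum_ext; intros.
    now rewrite psum_S.
Qed.

Lemma psum_mult (f g : nat -> R) N :
  psum f N * psum g N = psum (fun n => psum (fun m => f n * g m) N) N.
Proof.
  rewrite Rmult_comm, <- psum_scal; apply psum_ext; intros.
  rewrite psum_scal; ring.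
Qed.

Lemma psum_single (f : nat -> R) i N :
  (1 <= i <= N)%nat -> (forall n, n <> i -> f n = 0) -> psum f N = f i.
Proof.
  intros Hi H.
  assert (H0 : forall M, (M < i)%nat -> psum f M = 0).
  { induction M as [|M IH]; intros HM; [apply psum_O|].
    rewrite psum_S, IH, H by lia; ring. }
  induction N as [|N IH]; [lia|].
  rewrite psum_S; destruct (Nat.eq_dec (S N) i) as [<-|Hne].
  - rewrite H0 by lia; ring.
  - rewrite IH, (H (S N)) by lia; ring.
Qed.

Lemma psum_truncate (f : nat -> R) K N :
  (K <= N)%nat -> (forall n, (K < n)%nat -> f n = 0) -> psum f N = psum f K.
Proof.
  intros HK H; induction HK as [|N HK IH]; [reflexivity|].
  rewrite psum_S, IH, H by lia; ring.
Qed.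

Lemma is_lim_seq_psum (f : nat -> nat -> R) (l : nat -> R) K :
  (forall k, (1 <= k <= K)%nat -> is_lim_seq (f k) (l k)) ->
  is_lim_seq (fun N => psum (fun k => f k N) K) (psum l K).
Proof.
  induction K as [|K IH]; intros H.
  - rewrite psum_O; apply is_lim_seq_ext with (fun _ => 0);
      [intros; now rewrite psum_O|apply is_lim_seq_const].
  - rewrite psum_S.
    apply is_lim_seq_ext with (fun N => psum (fun k => f k N) K + f (S K) N);
      [intros; now rewrite psum_S|].
    apply is_lim_seq_plus'; [apply IH; intros|]; apply H; lia.
Qed.

Lemma psum_Series1 (f : nat -> R) N :
  sum_n (fun m => f (S m)) N = psum f (S N).
Proof.
  induction N as [|N IH].
  - now rewrite sum_O, psum_S, psum_O, Rplus_0_l.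
  - now rewrite sum_Sn, IH, (psum_S f (S N)).
Qed.

Lemma Series1_unique (f : nat -> R) (l : R) :
  is_lim_seq (fun N => psum f N) l -> Series1 f = l.
Proof.
  intros H; apply is_series_unique.
  change (is_lim_seq (sum_n (fun m => f (S m))) l).
  apply is_lim_seq_ext with (fun N => psum f (S N));
    [intros; now rewrite psum_Series1|].
  now apply is_lim_seq_incr_1 in H.
Qed.

Lemma is_lim_seq_Series1 (f : nat -> R) :
  ex_finite_lim_seq (fun N => psum f N) ->
  is_lim_seq (fun N => psum f N) (Series1 f).
Proof. intros [l H]; now rewrite (Series1_unique f l H). Qed.

(** * Convergence of the truncations of [ttilde] and [zeta] *)

Lemma half_pos n : (1 <= n)%nat -> 1 / 2 <= half n.
Proof. intros H; apply le_INR in H; simpl in H; lra. Qed.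

Lemma inv_half_bound n : (1 <= n)%nat -> 0 < / half n <= 2.
Proof.
  intros H; apply half_pos in H; split; [apply Rinv_0_lt_compat; lra|].
  replace 2 with (/ (1 / 2)) by field; apply Rinv_le_contravar; lra.
Qed.

Lemma inv_INR_le_half n : (1 <= n)%nat -> 0 < / INR n <= / half n.
Proof.
  intros H; apply half_pos in H; split; [apply Rinv_0_lt_compat; lra|].
  apply Rinv_le_contravar; lra.
Qed.

(** Reduces every power of 1/(n - 1/2), which is at most 2, to a first power at the cost of a
    constant. *)
Lemma pow_le_linear x p : 0 <= x <= 2 -> (1 <= p)%nat -> x ^ p <= 2 ^ p * x.
Proof.
  intros Hx Hp; destruct p as [|p]; [lia|].
  simpl; rewrite Rmult_comm; apply Rmult_le_compat_r; [lra|].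
  assert (H : x ^ p <= 2 ^ p) by (now apply pow_incr).
  assert (0 < 2 ^ p) by (apply pow_lt; lra); lra.
Qed.

(** Telescoping: (n - 1/2)^2 >= n (n - 1), so each term after the first is at most 1/(n - 1) - 1/n;
    the first term is 4 = 5 - 1. *)
Lemma psum_inv_half_sq_bound N : psum (fun n => (/ half n) ^ 2) (S N) <= 5 - / INR (S N).
Proof.
  induction N as [|N IH]; [rewrite psum_S, psum_O; simpl; lra|].
  rewrite psum_S; enough ((/ half (S (S N))) ^ 2 <= / INR (S N) - / INR (S (S N))) by lra.
  assert (H := pos_INR N); rewrite !S_INR.
  replace (/ (INR N + 1) - / (INR N + 1 + 1)) with (/ ((INR N + 1) * (INR N + 1 + 1)))
    by (field; lra).
  rewrite pow_inv; apply Rinv_le_contravar; nra.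
Qed.

(** The truncations increase and are bounded through the sum of squares. A general [x] below 1/(n -
    1/2) lets one proof serve both [ttilde] and [zeta]. *)
Lemma ex_lim_psum_pow (x : nat -> R) s :
  (2 <= s)%nat -> (forall n, (1 <= n)%nat -> 0 <= x n <= / half n) ->
  ex_finite_lim_seq (fun N => psum (fun n => x n ^ s) N).
Proof.
  intros Hs Hx; apply ex_finite_lim_seq_incr with (M := 2 ^ (s - 1) * 5).
  - intros N; rewrite psum_S.
    enough (0 <= x (S N) ^ s) by lra; apply pow_le, Hx; lia.
  - intros N.
    apply Rle_trans with (psum (fun n => 2 ^ (s - 1) * (/ half n) ^ 2) N).
    + apply psum_le; intros n Hn.
      destruct (Hx n) as [H0 H1]; [lia|].
      destruct (inv_half_bound n) as [H2 H3]; [lia|].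
      apply Rle_trans with ((/ half n) ^ s); [now apply pow_incr|].
      replace s with (S (s - 1)) at 1 by lia; simpl.
      assert (H := pow_le_linear (/ half n) (s - 1) ltac:(lra) ltac:(lia)).
      apply (Rmult_le_compat_l (/ half n)) in H; lra.
    + rewrite psum_scal; apply Rmult_le_compat_l; [apply pow_le; lra|].
      destruct N as [|N]; [rewrite psum_O; lra|].
      assert (H := psum_inv_half_sq_bound N).
      assert (0 < / INR (S N)) by apply Rinv_0_lt_compat, lt_0_INR, Nat.lt_0_succ; lra.
Qed.

Lemma is_lim_psum_ttilde s : (2 <= s)%nat ->
  is_lim_seq (fun N => psum (fun n => (/ half n) ^ s) N) (ttilde s).
Proof.
  intros Hs.
  apply is_lim_seq_ext with (fun N => psum (fun n => / half n ^ s) N).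
  { intros N; apply psum_ext; intros; now rewrite pow_inv. }
  apply is_lim_seq_Series1.
  destruct (ex_lim_psum_pow (fun n => / half n) s) as [l Hl]; [easy| |].
  { intros n Hn; destruct (inv_half_bound n Hn); lra. }
  exists l; revert Hl; apply is_lim_seq_ext.
  intros N; apply psum_ext; intros; now rewrite pow_inv.
Qed.

Lemma is_lim_psum_zeta s : (2 <= s)%nat ->
  is_lim_seq (fun N => psum (fun n => (/ INR n) ^ s) N) (zeta s).
Proof.
  intros Hs.
  apply is_lim_seq_ext with (fun N => psum (fun n => / INR n ^ s) N).
  { intros N; apply psum_ext; intros; now rewrite pow_inv. }
  apply is_lim_seq_Series1.
  destruct (ex_lim_psum_pow (fun n => / INR n) s) as [l Hl]; [easy| |].
  { intros n Hn; destruct (inv_INR_le_half n Hn); lra. }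
  exists l; revert Hl; apply is_lim_seq_ext.
  intros N; apply psum_ext; intros; now rewrite pow_inv.
Qed.

(** * Growth of h_n *)

Lemma h1_O : h 1 0 = 0.
Proof. exact (psum_O (fun k => / half k ^ 1)). Qed.

Lemma h1_psum n : psum (fun k => / half k) n = h 1 n.
Proof.
  change (psum (fun k => / half k) n = psum (fun k => / half k ^ 1) n).
  apply psum_ext; intros; now rewrite pow_1.
Qed.

Lemma h1_S n : h 1 (S n) = h 1 n + / (INR n + 1 / 2).
Proof.
  rewrite <- !h1_psum, psum_S, S_INR.
  now replace (INR n + 1 - 1 / 2) with (INR n + 1 / 2) by lra.
Qed.

(** The increment has d positive terms, the first and largest being 1/(n + 1/2). *)
Lemma h1_increment_bound n d : 0 <= h 1 (n + d) - h 1 n <= INR d / (INR n + 1 / 2).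
Proof.
  assert (Hn := pos_INR n); induction d as [|d IH].
  - rewrite Nat.add_0_r; simpl; unfold Rdiv; lra.
  - rewrite Nat.add_succ_r, h1_S, plus_INR, S_INR; assert (Hd := pos_INR d).
    assert (0 < / (INR n + INR d + 1 / 2)) by (apply Rinv_0_lt_compat; lra).
    assert (/ (INR n + INR d + 1 / 2) <= / (INR n + 1 / 2))
      by (apply Rinv_le_contravar; lra).
    unfold Rdiv in *; lra.
Qed.

(** A crude substitute for logarithmic growth, enough for h_N / N -> 0. *)
Lemma h1_sqrt_bound n : 0 <= h 1 n <= 4 * sqrt (INR n).
Proof.
  induction n as [|n IH]; [rewrite h1_O; simpl; rewrite sqrt_0; lra|].
  assert (Hn := pos_INR n); rewrite h1_S, S_INR.
  assert (0 < / (INR n + 1 / 2)) by (apply Rinv_0_lt_compat; lra).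
  assert (Ha := sqrt_pos (INR n)); assert (Hb : 1 <= sqrt (INR n + 1))
    by (rewrite <- sqrt_1 at 1; apply sqrt_le_1_alt; lra).
  assert (Ea := sqrt_sqrt (INR n) Hn); assert (Eb := sqrt_sqrt (INR n + 1) ltac:(lra)).
  set (a := sqrt (INR n)) in *; set (b := sqrt (INR n + 1)) in *.
  enough (/ (INR n + 1 / 2) <= 4 * (b - a)) by lra.
  (* Here b^2 - a^2 = 1. *)
  assert (E : b - a = / (a + b)) by (apply Rmult_eq_reg_r with (a + b); [rewrite Rinv_l by lra; nra|lra]).
  rewrite E; replace (4 * / (a + b)) with (/ ((a + b) / 4)) by (field; lra).
  (* From 2 a <= a^2 + 1 and 2 b <= b^2 + 1 follows (a + b)/4 <= (2 n + 3)/8 <= n + 1/2. *)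
  assert (Sa := Rle_0_sqr (a - 1)); assert (Sb := Rle_0_sqr (b - 1)); unfold Rsqr in *.
  apply Rinv_le_contravar; lra.
Qed.

Lemma h1_sublinear : is_lim_seq (fun N => h 1 N / INR N) 0.
Proof.
  apply is_lim_seq_le_le_loc with (fun _ => 0) (fun N => 4 * / sqrt (INR N)).
  - exists 1%nat; intros N HN; apply le_INR in HN; simpl in HN.
    destruct (h1_sqrt_bound N) as [H0 H1].
    assert (0 < / INR N) by (apply Rinv_0_lt_compat; lra).
    split; [apply Rmult_le_pos; lra|].
    assert (Hs : 0 < sqrt (INR N)) by (apply sqrt_lt_R0; lra).
    replace (/ sqrt (INR N)) with (sqrt (INR N) * / INR N).
    + unfold Rdiv; rewrite <- Rmult_assoc; apply Rmult_le_compat_r; lra.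
    + rewrite <- (sqrt_sqrt (INR N)) at 2 by lra; field; lra.
  - apply is_lim_seq_const.
  - replace (Finite 0) with (Rbar_mult 4 0) by (simpl; f_equal; ring).
    apply is_lim_seq_scal_l.
    change (Finite 0) with (Rbar_inv p_infty); apply is_lim_seq_inv; [|easy].
    refine (filterlim_comp _ _ _ INR sqrt _ _ _ is_lim_seq_INR filterlim_sqrt_p).
Qed.

(** * Partial fractions and sums of the kernel *)

Lemma psum_inv_add_half n N :
  psum (fun m => / (INR m + half n)) N = h 1 (N + n) - h 1 n.
Proof.
  induction N as [|N IH]; [rewrite psum_O; simpl; ring|].
  rewrite psum_S, IH, Nat.add_succ_l, h1_S, plus_INR, S_INR.
  replace (INR N + 1 + (INR n - 1 / 2)) with (INR N + INR n + 1 / 2) by lra; ring.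
Qed.

Lemma inv_opp_half i : / (- (INR i + 1 / 2)) = - / (INR i + 1 / 2).
Proof. assert (H := pos_INR i); field; lra. Qed.

(** The point i + 1/2 splits the range: the i terms below it are negative and add up to -h_i, the j
    terms above it add up to h_j. The upper limit is written i + j to avoid truncated
    subtraction. *)
Lemma psum_inv_sub_half i j :
  psum (fun m => / (INR m - (INR i + 1 / 2))) (i + j) = h 1 j - h 1 i.
Proof.
  induction j as [|j IH].
  - rewrite Nat.add_0_r, h1_O; induction i as [|i IH]; [rewrite psum_O, h1_O; ring|].
    rewrite psum_shift, h1_S.
    rewrite (psum_ext _ (fun m => / (INR m - (INR i + 1 / 2)))).
    + change (INR 1) with 1; rewrite IH, S_INR.
      replace (1 - (INR i + 1 + 1 / 2)) with (- (INR i + 1 / 2)) by lra.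
      rewrite inv_opp_half; ring.
    + intros m _; rewrite !S_INR; f_equal; ring.
  - rewrite Nat.add_succ_r, psum_S, IH, h1_S, S_INR, plus_INR.
    replace (INR i + INR j + 1 - (INR i + 1 / 2)) with (INR j + 1 / 2) by lra; ring.
Qed.

(** Parity: equality would give 2 m + 1 = 2 n. *)
Lemma INR_sub_half_neq0 n m :
  INR m - half n <> 0.
Proof.
  intros H; assert (E : (2 * INR m + 1 = 2 * INR n)%R) by lra.
  replace (2 * INR m + 1) with (INR (2 * m + 1)) in E
    by (rewrite plus_INR, mult_INR; simpl; ring).
  replace (2 * INR n) with (INR (2 * n)) in E by (rewrite mult_INR; simpl; ring).
  apply INR_eq in E; lia.
Qed.

Definition kern n m := / (INR m ^ 2 - half n ^ 2).

Lemma INR_add_half_neq0 n m : (1 <= n)%nat -> INR m + half n <> 0.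
Proof. intros H; apply half_pos in H; assert (K := pos_INR m); lra. Qed.

(** With a = i + 1/2, the kernel is (1/(m - a) - 1/(m + a)) / (2 a). Since h_(i+1) - h_i = 1/a, the
    main term is 1/(2 a^2); the difference of [h] values is the error of truncating at i + j. *)
Lemma kern_sum_INR i j :
  psum (fun m => kern (S i) m) (i + j) =
  / half (S i) / 2 * (/ half (S i) - (h 1 (j + (2 * i + 1)) - h 1 j)).
Proof.
  assert (Hh := half_pos (S i) ltac:(lia)).
  rewrite (psum_ext _ (fun m => / half (S i) / 2 *
     (/ (INR m - (INR i + 1 / 2)) - / (INR m + half (S i))))).
  - rewrite psum_scal, psum_minus, psum_inv_add_half, psum_inv_sub_half.
    f_equal; rewrite (h1_S i).
    replace (j + (2 * i + 1))%nat with (i + j + S i)%nat by lia.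
    replace (half (S i)) with (INR i + 1 / 2) by (rewrite S_INR; lra); ring.
  - intros m Hm; unfold kern.
    assert (H1 := INR_sub_half_neq0 (S i) m); assert (H2 := INR_add_half_neq0 (S i) m ltac:(lia)).
    rewrite S_INR in *.
    replace (INR m ^ 2 - (INR i + 1 - 1 / 2) ^ 2) with
      ((INR m - (INR i + 1 / 2)) * (INR m + (INR i + 1 - 1 / 2))) by field.
    field; repeat split; lra.
Qed.

(** Here 1/(m (m^2 - a^2)) = ((1/(m - a) + 1/(m + a))/2 - 1/m) / a^2, so the values of h add instead
    of cancelling and have to be balanced by the harmonic sum. *)
Lemma kern_sum_inv_INR i j :
  psum (fun m => / INR m * kern (S i) m) (i + j) =
  (/ half (S i)) ^ 2 * ((h 1 (j + (2 * i + 1)) + h 1 j) / 2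
     - psum (fun m => / INR m) (i + j) - h 1 i - / half (S i) / 2).
Proof.
  assert (Hh := half_pos (S i) ltac:(lia)).
  rewrite (psum_ext _ (fun m => (/ half (S i)) ^ 2 *
     (/ 2 * (/ (INR m - (INR i + 1 / 2)) + / (INR m + half (S i))) - / INR m))).
  - rewrite psum_scal, psum_minus, psum_scal, psum_plus, psum_inv_add_half, psum_inv_sub_half.
    f_equal; rewrite (h1_S i).
    replace (j + (2 * i + 1))%nat with (i + j + S i)%nat by lia.
    replace (half (S i)) with (INR i + 1 / 2) by (rewrite S_INR; lra); field.
    assert (H := pos_INR i); lra.
  - intros m Hm; unfold kern.
    assert (H1 := INR_sub_half_neq0 (S i) m); assert (H2 := INR_add_half_neq0 (S i) m ltac:(lia)).
    assert (H3 : 1 <= INR m) by (change 1 with (INR 1); apply le_INR; lia).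
    rewrite S_INR in *.
    replace (INR m ^ 2 - (INR i + 1 - 1 / 2) ^ 2) with
      ((INR m - (INR i + 1 / 2)) * (INR m + (INR i + 1 - 1 / 2))) by field.
    field; repeat split; lra.
Qed.

(** With the roles of the indices exchanged, both partial fractions contribute the same h_i. It
    cancels, so only a truncation error remains. *)
Lemma kern_sum_half i j : (1 <= i)%nat ->
  psum (fun n => kern n i) (i + j) = / INR i / 2 * (h 1 (j + 2 * i) - h 1 j).
Proof.
  intros Hi; assert (H3 : 1 <= INR i) by (change 1 with (INR 1); apply le_INR; lia).
  rewrite (psum_ext _ (fun n => / INR i / 2 *
     (/ (INR n + half i) - / (INR n - (INR i + 1 / 2))))).
  - rewrite psum_scal, psum_minus, psum_inv_add_half, psum_inv_sub_half.
    replace (j + 2 * i)%nat with (i + j + i)%nat by lia; ring.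
  - intros n Hn; unfold kern.
    assert (H1 := INR_sub_half_neq0 n i); assert (H2 := INR_add_half_neq0 n i ltac:(lia)).
    replace (INR i ^ 2 - half n ^ 2) with ((INR i - half n) * (INR i + half n)) by field.
    field; repeat split; lra.
Qed.

(** The two exponents always add up to 2 K + 2 + c = q + 1: c = 0 serves q = 2 K + 1 and c = 1
    serves q = 2 K + 2. In the induction, raising K multiplies the old terms by m^(-2) and adds one
    new term. *)
Lemma kern_geometric K c n m : (1 <= n)%nat -> (1 <= m)%nat ->
  psum (fun k => (/ half n) ^ (2 * k) * (/ INR m) ^ (2 * (K - k) + 2 + c)) K =
  ((/ half n) ^ (2 * K) - (/ INR m) ^ (2 * K)) * (/ INR m) ^ c * kern n m.
Proof.
  intros Hn Hm.
  assert (H1 := INR_sub_half_neq0 n m); assert (H2 := INR_add_half_neq0 n m Hn).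
  apply half_pos in Hn; apply le_INR in Hm; simpl (INR 1) in Hm.
  induction K as [|K IH]; [rewrite psum_O; simpl; ring|].
  rewrite psum_S, (psum_ext _ (fun k => (/ INR m) ^ 2 *
    ((/ half n) ^ (2 * k) * (/ INR m) ^ (2 * (K - k) + 2 + c)))).
  - rewrite psum_scal, IH.
    replace (2 * (S K - S K) + 2 + c)%nat with (2 + c)%nat by lia.
    replace (2 * S K)%nat with (2 * K + 2)%nat by lia.
    rewrite !pow_add; generalize ((/ half n) ^ (2 * K)) ((/ INR m) ^ (2 * K)) ((/ INR m) ^ c).
    intros x y z; unfold kern.
    replace (INR m ^ 2 - half n ^ 2) with ((INR m - half n) * (INR m + half n)) by ring.
    field; repeat split; lra.
  - intros k Hk; replace (2 * (S K - k) + 2 + c)%nat with (2 + (2 * (K - k) + 2 + c))%nat by lia.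
    rewrite (pow_add _ 2); ring.
Qed.

(** * Vanishing of the truncation errors *)

Lemma is_lim_seq_abs_le_h1 (u : nat -> R) C :
  (forall N, (1 <= N)%nat -> Rabs (u N) <= C * (h 1 N / INR N)) -> is_lim_seq u 0.
Proof.
  intros H; apply is_lim_seq_abs_0.
  apply is_lim_seq_le_le_loc with (fun _ => 0) (fun N => C * (h 1 N / INR N)).
  - exists 1%nat; intros N HN; split; [apply Rabs_pos|now apply H].
  - apply is_lim_seq_const.
  - replace (Finite 0) with (Rbar_mult C 0) by (simpl; f_equal; ring).
    apply is_lim_seq_scal_l, h1_sublinear.
Qed.

Lemma inv_mul_split x y : 0 < x -> 0 < y -> / x * / y = / (x + y) * (/ x + / y).
Proof. intros; field; lra. Qed.

(** After reducing x^(-p) to 2^p / x, the identity 1/(x y) = (1/x + 1/y)/(x + y) and x + y >= N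
    extract a factor 1/N. What is left sums to at most 2 h_N. *)
Lemma boundary_sum_vanishes p (x : nat -> R) (y r : nat -> nat -> R) :
  (1 <= p)%nat ->
  (forall n N, (1 <= n <= N)%nat ->
     half n <= x n /\ half (S N - n) <= y N n /\ INR N <= x n + y N n /\
     Rabs (r N n) <= (/ x n) ^ p * / y N n) ->
  is_lim_seq (fun N => psum (r N) N) 0.
Proof.
  intros Hp Hr; apply (is_lim_seq_abs_le_h1 _ (2 ^ p * 2)); intros N HN.
  assert (HN' : 1 <= INR N) by (change 1 with (INR 1); now apply le_INR).
  assert (H2 : 0 < 2 ^ p) by (apply pow_lt; lra).
  apply Rle_trans with (psum (fun n => 2 ^ p * / INR N *
    (/ half n + / half (S N - n))) N).
  - apply psum_abs_le; intros n Hn.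
    destruct (Hr n N Hn) as (Hx & Hy & Hxy & Hb); eapply Rle_trans; [exact Hb|].
    assert (Ha := half_pos n ltac:(lia)); assert (Hc := half_pos (S N - n) ltac:(lia)).
    destruct (inv_half_bound n) as [Hd He]; [lia|].
    assert (Hx0 : 0 < / x n) by (apply Rinv_0_lt_compat; lra).
    assert (Hy0 : 0 < / y N n) by (apply Rinv_0_lt_compat; lra).
    assert (Hx1 : / x n <= / half n) by (apply Rinv_le_contravar; lra).
    assert (Hy1 : / y N n <= / half (S N - n)) by (apply Rinv_le_contravar; lra).
    assert (Hq := pow_le_linear (/ x n) p ltac:(lra) Hp).
    apply Rle_trans with (2 ^ p * (/ x n * / y N n)).
    + rewrite <- Rmult_assoc; apply Rmult_le_compat_r; lra.
    + rewrite Rmult_assoc; apply Rmult_le_compat_l; [lra|].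
      rewrite inv_mul_split by lra.
      apply Rmult_le_compat; [left; apply Rinv_0_lt_compat; lra|lra| |lra].
      apply Rinv_le_contravar; lra.
  (* Reversal n -> N + 1 - n turns the second sum into h_N as well, whence the constant 2^p * 2. *)
  - rewrite psum_scal, psum_plus, (psum_rev (fun n => / half n)), h1_psum.
    right; field; lra.
Qed.

Lemma boundary_sum_half_vanishes p (r : nat -> nat -> R) : (1 <= p)%nat ->
  (forall n N, (1 <= n <= N)%nat ->
     Rabs (r N n) <= (/ half n) ^ p * / (INR (S N - n) + 1 / 2)) ->
  is_lim_seq (fun N => psum (r N) N) 0.
Proof.
  intros Hp Hr.
  apply (boundary_sum_vanishes p (fun n => half n) (fun N n => INR (S N - n) + 1 / 2));
    [exact Hp|].
  intros n N Hn; specialize (Hr n N Hn); repeat split; try exact Hr; try lra.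
  rewrite minus_INR, S_INR by lia; lra.
Qed.

Lemma boundary_sum_INR_vanishes p (r : nat -> nat -> R) : (1 <= p)%nat ->
  (forall n N, (1 <= n <= N)%nat ->
     Rabs (r N n) <= (/ INR n) ^ p * / (INR (N - n) + 1 / 2)) ->
  is_lim_seq (fun N => psum (r N) N) 0.
Proof.
  intros Hp Hr.
  apply (boundary_sum_vanishes p INR (fun N n => INR (N - n) + 1 / 2)); [exact Hp|].
  intros n N Hn; specialize (Hr n N Hn); repeat split; try exact Hr;
    rewrite ?minus_INR, ?S_INR by lia; lra.
Qed.

(** * The limit of h_N - H_N *)

Lemma ln_step_bound k : 0 < k -> / (k + 1) <= ln (k + 1) - ln k <= / k.
Proof.
  intros Hk.
  assert (Hexp : forall x, 0 < x -> ln x <= x - 1).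
  { intros x Hx; assert (H := exp_ineq1_le (ln x)); rewrite exp_ln in H; lra. }
  split.
  - assert (H := Hexp (k / (k + 1)) ltac:(apply Rdiv_lt_0_compat; lra)).
    rewrite ln_div in H by lra.
    replace (k / (k + 1) - 1) with (- / (k + 1)) in H by (field; lra); lra.
  - assert (H := Hexp ((k + 1) / k) ltac:(apply Rdiv_lt_0_compat; lra)).
    rewrite ln_div in H by lra.
    replace ((k + 1) / k - 1) with (/ k) in H by (field; lra); lra.
Qed.

Lemma harmonic_increment_bound N d : (1 <= N)%nat ->
  ln (INR (N + d) + 1) - ln (INR N + 1)
    <= psum (fun k => / INR k) (N + d) - psum (fun k => / INR k) N
    <= ln (INR (N + d)) - ln (INR N).
Proof.
  intros HN; induction d as [|d IH]; [rewrite Nat.add_0_r; lra|].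
  assert (H : 1 <= INR (N + d)) by (change 1 with (INR 1); apply le_INR; lia).
  rewrite Nat.add_succ_r, psum_S, S_INR.
  assert (H1 := ln_step_bound (INR (N + d)) ltac:(lra)).
  assert (H2 := ln_step_bound (INR (N + d) + 1) ltac:(lra)); lra.
Qed.

(** As 1/(k - 1/2) = 2/(2 k - 1), h_N is twice the sum of the odd reciprocals below 2 N, that is 2
    (H_(2N) - H_N / 2). *)
Lemma h1_harmonic N :
  h 1 N = 2 * psum (fun k => / INR k) (N + N) - psum (fun k => / INR k) N.
Proof.
  induction N as [|N IH]; [rewrite h1_O; simpl; rewrite psum_O; ring|].
  rewrite h1_S, IH, Nat.add_succ_r, Nat.add_succ_l, !psum_S, !S_INR, plus_INR.
  assert (H := pos_INR N); field; lra.
Qed.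

(** The difference equals 2 (H_(2N) - H_N), squeezed between logarithms of ratios tending to 2. *)
Lemma is_lim_h1_minus_harmonic :
  is_lim_seq (fun N => h 1 N - psum (fun k => / INR k) N) (2 * ln 2).
Proof.
  apply is_lim_seq_le_le_loc with (fun N => 2 * ln 2 - 2 * / INR N) (fun _ => 2 * ln 2).
  - exists 1%nat; intros N HN; rewrite h1_harmonic.
    assert (H := harmonic_increment_bound N N HN).
    apply le_INR in HN; simpl in HN; rewrite plus_INR in H.
    assert (E1 : ln (INR N + INR N) = ln 2 + ln (INR N))
      by (rewrite <- ln_mult by lra; f_equal; ring).
    assert (E2 : ln (INR N + INR N + 1 + 1) = ln 2 + ln (INR N + 1))
      by (rewrite <- ln_mult by lra; f_equal; ring).
    (* The lower bound involves ln (2 N + 1); one more step reaches ln (2 N + 2) = ln 2 + ln (N + 1)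
       at a cost of at most 1/(2 N + 1). *)
    assert (H1 := ln_step_bound (INR N + INR N + 1) ltac:(lra)).
    assert (/ (INR N + INR N + 1) <= / INR N) by (apply Rinv_le_contravar; lra).
    lra.
  - replace (2 * ln 2) with (2 * ln 2 - 2 * 0) at 1 by ring.
    apply is_lim_seq_minus'; [apply is_lim_seq_const|].
    apply is_lim_seq_mult'; [apply is_lim_seq_const|].
    change (Finite 0) with (Rbar_inv p_infty); apply is_lim_seq_inv; [|easy].
    apply is_lim_seq_INR.
  - apply is_lim_seq_const.
Qed.

(** * Limits of the truncated double sums *)

(** The inner sum is pure truncation error: an increment of 2 m terms, at most 2 m / (N - m + 1/2),
    whose factor 2 m cancels the prefactor 1/(2 m). *)
Lemma is_lim_kern_half_sum p : (1 <= p)%nat ->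
  is_lim_seq (fun N =>
    psum (fun m => (/ INR m) ^ p * psum (fun n => kern n m) N) N) 0.
Proof.
  intros Hp; apply (boundary_sum_INR_vanishes p); [exact Hp|]; intros m N Hm.
  assert (Hx : 1 <= INR m) by (change 1 with (INR 1); apply le_INR; lia).
  assert (Hy := pos_INR (N - m)).
  assert (Hi : 0 < / INR m) by (apply Rinv_0_lt_compat; lra).
  replace N with (m + (N - m))%nat at 1 by lia.
  rewrite kern_sum_half by lia.
  assert (H := h1_increment_bound (N - m) (2 * m)).
  set (D := h 1 (N - m + 2 * m) - h 1 (N - m)) in *.
  rewrite mult_INR in H; simpl (INR 2) in H.
  assert (Hp0 : 0 < (/ INR m) ^ p) by now apply pow_lt.
  rewrite Rabs_pos_eq.
  - apply Rmult_le_compat_l; [lra|].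
    apply Rle_trans with (/ INR m / 2 * ((1 + 1) * INR m / (INR (N - m) + 1 / 2))).
    + apply Rmult_le_compat_l; lra.
    + right; field; lra.
  - apply Rmult_le_pos; [lra|apply Rmult_le_pos; lra].
Qed.

(** The gap has 2 i + 1 = 2 (i + 1/2) terms, so bounding it costs exactly one factor 1/(i + 1/2). *)
Lemma half_h1_gap_bound i j p :
  0 <= (/ half (S i)) ^ (p + 1) * ((h 1 (j + (2 * i + 1)) - h 1 j) / 2)
    <= (/ half (S i)) ^ p * / (INR j + 1 / 2).
Proof.
  assert (H := h1_increment_bound j (2 * i + 1)).
  assert (Ha := half_pos (S i) ltac:(lia)); assert (Hj := pos_INR j).
  assert (Hx : 0 < / half (S i)) by (apply Rinv_0_lt_compat; lra).
  assert (Hp : 0 < (/ half (S i)) ^ p) by now apply pow_lt.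
  rewrite pow_add, pow_1, Rmult_assoc.
  split; [apply Rmult_le_pos; [lra|apply Rmult_le_pos; lra]|].
  apply Rmult_le_compat_l; [lra|].
  apply Rle_trans with (/ half (S i) * (INR (2 * i + 1) / (INR j + 1 / 2) / 2)).
  - apply Rmult_le_compat_l; lra.
  - rewrite plus_INR, mult_INR, S_INR in *; simpl (INR 2); simpl (INR 1).
    right; field; lra.
Qed.

Lemma is_lim_kern_INR_sum p : (1 <= p)%nat ->
  is_lim_seq (fun N =>
    psum (fun n => (/ half n) ^ p * psum (fun m => kern n m) N) N) (ttilde (p + 2) / 2).
Proof.
  intros Hp.
  (* Main term minus the sum of its deviations from the true inner sums; the deviations form a
     boundary sum. *)
  apply is_lim_seq_ext with (fun N => / 2 * psum (fun n => (/ half n) ^ (p + 2)) N -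
    psum (fun n => / 2 * (/ half n) ^ (p + 2)
            - (/ half n) ^ p * psum (fun m => kern n m) N) N).
  { intros N; rewrite psum_minus, psum_scal; ring. }
  replace (ttilde (p + 2) / 2) with (/ 2 * ttilde (p + 2) - 0) by field.
  apply is_lim_seq_minus'.
  - apply is_lim_seq_mult'; [apply is_lim_seq_const|apply is_lim_psum_ttilde; lia].
  - apply (boundary_sum_half_vanishes p); [exact Hp|]; intros n N Hn.
    destruct n as [|i]; [lia|].
    replace N with (i + (S N - S i))%nat at 1 by lia.
    rewrite kern_sum_INR; set (j := (S N - S i)%nat).
    assert (H := half_h1_gap_bound i j p).
    assert (Ha := half_pos (S i) ltac:(lia)).
    replace (/ 2 * (/ half (S i)) ^ (p + 2) - _) with
      ((/ half (S i)) ^ (p + 1) * ((h 1 (j + (2 * i + 1)) - h 1 j) / 2)).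
    + now rewrite Rabs_pos_eq.
    + rewrite !pow_add; field; lra.
Qed.

(** The part containing h_(n-1) is kept on the left: it is the partial sum of T, whose convergence
    is not yet available. The value p = 0 occurs for q = 2. *)
Lemma is_lim_kern_inv_INR_sum p :
  is_lim_seq (fun N =>
    psum (fun n => (/ half n) ^ p * psum (fun m => / INR m * kern n m) N) N
    + psum (fun n => h 1 (n - 1) * (/ half n) ^ (p + 2)) N)
    (2 * ln 2 * ttilde (p + 2) - ttilde (p + 3) / 2).
Proof.
  apply is_lim_seq_ext with (fun N =>
    (h 1 N - psum (fun k => / INR k) N) * psum (fun n => (/ half n) ^ (p + 2)) N
    - / 2 * psum (fun n => (/ half n) ^ (p + 3)) N
    + psum (fun n =>
        (/ half n) ^ p * psum (fun m => / INR m * kern n m) N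
        + h 1 (n - 1) * (/ half n) ^ (p + 2)
        - (h 1 N - psum (fun k => / INR k) N) * (/ half n) ^ (p + 2)
        + / 2 * (/ half n) ^ (p + 3)) N).
  { intros N; rewrite !psum_plus, psum_minus, psum_plus, !psum_scal; ring. }
  replace (2 * ln 2 * ttilde (p + 2) - ttilde (p + 3) / 2)
    with (2 * ln 2 * ttilde (p + 2) - / 2 * ttilde (p + 3) + 0) by field.
  apply is_lim_seq_plus'; [apply is_lim_seq_minus'; apply is_lim_seq_mult'|].
  - apply is_lim_h1_minus_harmonic.
  - apply is_lim_psum_ttilde; lia.
  - apply is_lim_seq_const.
  - apply is_lim_psum_ttilde; lia.
  - apply (boundary_sum_half_vanishes (p + 1)); [lia|]; intros n N Hn.
    destruct n as [|i]; [lia|].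
    replace N with (i + (S N - S i))%nat at 1 by lia.
    rewrite kern_sum_inv_INR.
    replace (i + (S N - S i))%nat with N by lia.
    replace (S i - 1)%nat with i by lia.
    set (j := (S N - S i)%nat).
    assert (H := half_h1_gap_bound i j (p + 1)).
    assert (Ha := half_pos (S i) ltac:(lia)).
    (* Only h_j <= h_N <= h_(j+2i+1) is used: the error is a difference of two nonnegative pieces
       whose sum is half the gap from h_j to h_(j+2i+1). *)
    assert (H1 := h1_increment_bound j i); assert (H2 := h1_increment_bound N (S i)).
    replace (j + i)%nat with N in H1 by lia.
    replace (N + S i)%nat with (j + (2 * i + 1))%nat in H2 by lia.
    assert (Hx : 0 < (/ half (S i)) ^ (p + 2))
      by (apply pow_lt, Rinv_0_lt_compat; lra).
    replace (_ + / 2 * _) with ((/ half (S i)) ^ (p + 2) *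
      ((h 1 (j + (2 * i + 1)) - h 1 N) / 2 - (h 1 N - h 1 j) / 2)).
    + eapply Rle_trans; [|apply H].
      replace (p + 1 + 1)%nat with (p + 2)%nat by lia.
      rewrite Rabs_mult, (Rabs_pos_eq ((/ half (S i)) ^ (p + 2))) by lra.
      apply Rmult_le_compat_l; [lra|]; apply Rabs_le; lra.
    + rewrite !pow_add; field; lra.
Qed.

(** * The convolution sum and the two parities of q *)

(** K is the largest k1 that leaves room for k2 >= 1; each k1 <= K then has the single partner k2 =
    q - 2 k1. *)
Lemma convolution_collapse q K : (2 * K < q <= 2 * K + 2)%nat ->
  sum_n_m (fun k1 => sum_n_m (fun k2 =>
      if Nat.eqb (2 * k1 + k2) q then ttilde (2 * k1) * zeta (k2 + 1) else 0) 1 q) 1 q =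
  psum (fun k => ttilde (2 * k) * zeta (q - 2 * k + 1)) K.
Proof.
  intros HK.
  change (psum (fun k1 => psum (fun k2 =>
      if Nat.eqb (2 * k1 + k2) q then ttilde (2 * k1) * zeta (k2 + 1) else 0) q) q =
  psum (fun k => ttilde (2 * k) * zeta (q - 2 * k + 1)) K).
  rewrite (psum_truncate _ K); [|lia|].
  - apply psum_ext; intros k Hk.
    rewrite (psum_single _ (q - 2 * k)); [|lia|].
    + replace (2 * k + (q - 2 * k))%nat with q by lia; now rewrite Nat.eqb_refl.
    + intros n Hn; destruct (Nat.eqb_spec (2 * k + n) q); [lia|reflexivity].
  - intros k Hk.
    rewrite (psum_ext _ (fun _ => 0 * 0)); [rewrite psum_scal; ring|].
    intros n Hn; destruct (Nat.eqb_spec (2 * k + n) q); [lia|ring].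
Qed.

(** At fixed N the products of truncated series form a finite triple sum. Summing over k first, by
    [kern_geometric], leaves the two double sums, while the limit is taken product by product. *)
Lemma is_lim_convolution K c :
  is_lim_seq (fun N =>
      psum (fun n => (/ half n) ^ (2 * K)
        * psum (fun m => (/ INR m) ^ c * kern n m) N) N
      - psum (fun m => (/ INR m) ^ (2 * K + c) * psum (fun n => kern n m) N) N)
    (psum (fun k => ttilde (2 * k) * zeta (2 * (K - k) + 2 + c)) K).
Proof.
  apply is_lim_seq_ext with (fun N => psum (fun k =>
    psum (fun n => (/ half n) ^ (2 * k)) N *
    psum (fun m => (/ INR m) ^ (2 * (K - k) + 2 + c)) N) K).
  - intros N.
    transitivity (psum (fun n => psum (fun m => psum (fun k =>
      (/ half n) ^ (2 * k) * (/ INR m) ^ (2 * (K - k) + 2 + c)) K) N) N).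
    + symmetry; rewrite (psum_ext _ (fun n => psum (fun k => psum (fun m =>
        (/ half n) ^ (2 * k) * (/ INR m) ^ (2 * (K - k) + 2 + c)) N) K))
        by (intros; apply psum_swap).
      rewrite psum_swap; apply psum_ext; intros; symmetry; apply psum_mult.
    + rewrite (psum_ext _ (fun n =>
        (/ half n) ^ (2 * K) * psum (fun m => (/ INR m) ^ c * kern n m) N
        - psum (fun m => (/ INR m) ^ (2 * K + c) * kern n m) N)).
      * rewrite psum_minus, (psum_swap (fun n m => (/ INR m) ^ (2 * K + c) * kern n m)).
        f_equal; apply psum_ext; intros; apply psum_scal.
      * intros n Hn; rewrite <- psum_scal, <- psum_minus; apply psum_ext; intros m Hm.
        rewrite kern_geometric, pow_add by lia; ring.
  - apply (is_lim_seq_psum (fun k N => psum (fun n => (/ half n) ^ (2 * k)) N *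
      psum (fun m => (/ INR m) ^ (2 * (K - k) + 2 + c)) N)).
    intros k Hk; apply is_lim_seq_mult';
      [apply is_lim_psum_ttilde|apply is_lim_psum_zeta]; lia.
Qed.

(** Case c = 0: the two double sums tend to [ttilde (2 * K + 2) / 2] and 0, and limits are
    unique. *)
Lemma convolution_odd K : (1 <= K)%nat ->
  psum (fun k => ttilde (2 * k) * zeta (2 * (K - k) + 2)) K = ttilde (2 * K + 2) / 2.
Proof.
  intros HK.
  assert (H := is_lim_convolution K 0).
  assert (H0 := is_lim_seq_minus' _ _ _ _
    (is_lim_kern_INR_sum (2 * K) ltac:(lia)) (is_lim_kern_half_sum (2 * K) ltac:(lia))).
  rewrite Rminus_0_r in H0.
  apply is_lim_seq_unique in H, H0.
  assert (E : Finite (psum (fun k => ttilde (2 * k) * zeta (2 * (K - k) + 2 + 0)) K)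
              = Finite (ttilde (2 * K + 2) / 2)).
  { rewrite <- H, <- H0; apply Lim_seq_ext; intros N; f_equal.
    - apply psum_ext; intros; f_equal; apply psum_ext; intros; simpl; ring.
    - apply psum_ext; intros; do 2 f_equal; lia. }
  apply Rbar_finite_eq in E; rewrite <- E; apply psum_ext; intros; do 2 f_equal; lia.
Qed.

Lemma T_even K :
  T [1%nat] (2 * K + 2) =
  2 * ln 2 * ttilde (2 * K + 2) - ttilde (2 * K + 3) / 2
  - psum (fun k => ttilde (2 * k) * zeta (2 * (K - k) + 3)) K.
Proof.
  (* Convergence of T comes with the identity: its partial sums are a combination
     of sequences already known to converge. *)
  apply Series1_unique.
  assert (H := is_lim_seq_minus' _ _ _ _
    (is_lim_seq_minus' _ _ _ _ (is_lim_kern_inv_INR_sum (2 * K)) (is_lim_convolution K 1))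
    (is_lim_kern_half_sum (2 * K + 1) ltac:(lia))).
  rewrite Rminus_0_r in H.
  rewrite (psum_ext (fun k => ttilde (2 * k) * zeta (2 * (K - k) + 3))
    (fun k => ttilde (2 * k) * zeta (2 * (K - k) + 2 + 1)))
    by (intros; do 2 f_equal; lia).
  revert H; apply is_lim_seq_ext; intros N.
  rewrite (psum_ext
    (fun n => (/ half n) ^ (2 * K) * psum (fun m => (/ INR m) ^ 1 * kern n m) N)
    (fun n => (/ half n) ^ (2 * K) * psum (fun m => / INR m * kern n m) N))
    by (intros; f_equal; apply psum_ext; intros; now rewrite pow_1).
  (* Here [a] and [c] are the two double sums of the convolution with c = 1, and [b] is the partial
     sum of T. *)
  match goal with |- ?a + ?b - (?a - ?c) - ?c = _ => replace (a + b - (a - c) - c) with b by ring end.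
  apply psum_ext; intros n Hn; simpl map; simpl fold_right.
  rewrite pow_inv; unfold Rdiv; ring.
Qed.

(* The constraints 2 k1 + k2 = q and k1, k2 >= 1 force k1, k2 <= q. *)
Theorem theorem2p3 (q : nat) (hq : (1 < q)%nat) :
  (1 + (-1) ^ q) * T [1%nat] q =
    (-1) ^ (q + 1) * ttilde (q + 1)
    + (1 + (-1) ^ q) * (2 * ln 2) * ttilde q
    - 2 * sum_n_m (fun k1 =>
            sum_n_m (fun k2 =>
              if Nat.eqb (2 * k1 + k2) q
              then ttilde (2 * k1) * zeta (k2 + 1)
              else 0) 1 q) 1 q.
Proof.
  (* Even q is 2 (K + 1), the case q = 0 being excluded; odd q is 2 K + 1, with K >= 1 because q >
     1. *)
  destruct (Nat.Even_or_Odd q) as [[[|K] Hq]|[K Hq]]; [lia| |].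
  - rewrite (convolution_collapse q K) by lia.
    replace q with (2 * K + 2)%nat in * by lia; clear Hq.
    rewrite (psum_ext _ (fun k => ttilde (2 * k) * zeta (2 * (K - k) + 3)))
      by (intros; do 2 f_equal; lia).
    rewrite T_even.
    replace (2 * K + 2 + 1)%nat with (2 * K + 3)%nat by lia.
    replace (2 * K + 2)%nat with (2 * S K)%nat by lia; rewrite pow_1_even.
    replace (2 * K + 3)%nat with (S (2 * S K)) by lia; rewrite pow_1_odd; field.
  (* For odd q the factor 1 + (-1)^q vanishes and T drops out; what remains evaluates the
     convolution alone. *)
  - rewrite (convolution_collapse q K) by lia.
    rewrite (psum_ext _ (fun k => ttilde (2 * k) * zeta (2 * (K - k) + 2)))
      by (intros; do 2 f_equal; lia).
    rewrite convolution_odd by lia.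
    replace (q + 1)%nat with (2 * K + 2)%nat by lia.
    replace ((-1) ^ q) with (-1) by (replace q with (S (2 * K)) by lia; now rewrite pow_1_odd).
    replace ((-1) ^ (2 * K + 2)) with 1
      by (replace (2 * K + 2)%nat with (2 * S K)%nat by lia; now rewrite pow_1_even).
    field.
Qed.
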